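(* Let $G$ be a connected finite simple graph, let $M$ be a generalized Laplacian on $G$ with eigenvalues $\lambda_1\le\cdots\le\lambda_n$ (listed with multiplicity, $n=|V_G|$), and suppose that $\lambda_k$ is a simple eigenvalue of $M$. Let $\mathbf f_k$ be an eigenvector of $M$ with eigenvalue $\lambda_k$, and let $s$ be the number of shallow Urschel vertices of $\mathbf f_k$. Then $$\mathrm{UN}_{2^s}(\mathbf f_k)\le k .$$
   Context: Graphs $G=(V_G,E_G)$ are finite and simple. A generalized Laplacian on $G$ is a symmetric real matrix $M\in\mathbb R^{V_G\times V_G}$ such that $M(u,v)=0$ whenever $u\ne v$ and $\{u,v\}\notin E_G$, and $M(u,v)<0$ for all $\{u,v\}\in E_G$. For a nonzero $\mathbf f:V_G\to\mathbb R$, a vertex $v$ is an Urschel vertex of $\mathbf f$ if $\mathbf f(v)=0$, and a non-Urschel vertex otherwise. An Urschel vertex is shallow if it is adjacent to at least one non-Urschel vertex, and deep otherwise. For $\mathbf f:V_G\to\mathbb R$, a strong nodal domain of $\mathbf f$ is a connected component of the subgraph of $G$ induced on $\{v:\mathbf f(v)>0\}$ or of the subgraph induced on $\{v:\mathbf f(v)<0\}$; $\mathrm{SND}(\mathbf f)$ is the number of strong nodal domains. A signing of $\mathbf f$ is a nowhere-zero function $\tilde{\mathbf f}:V_G\to\mathbb R$ with $\tilde{\mathbf f}(v)>0$ whenever $\mathbf f(v)>0$ and $\tilde{\mathbf f}(v)<0$ whenever $\mathbf f(v)<0$. Two signings are equivalent if they have the same sign at every vertex. If $\mathbf f$ vanishes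 at exactly $\ell$ vertices, there are $2^\ell$ equivalence classes of signings; choose representatives $\tilde{\mathbf f}_1,\ldots,\tilde{\mathbf f}_{2^\ell}$ ordered so that $\mathrm{SND}(\tilde{\mathbf f}_1)\le\cdots\le\mathrm{SND}(\tilde{\mathbf f}_{2^\ell})$. The $i$-th Urschel number of $\mathbf f$ is $\mathrm{UN}_i(\mathbf f)=\mathrm{SND}(\tilde{\mathbf f}_i)$ for $1\le i\le 2^\ell$. *)

(* Defs.v *)
From HB Require Import structures.
From mathcomp Require Import all_boot all_order all_algebra reals.

Set Implicit Arguments.
Unset Strict Implicit.
Unset Printing Implicit Defensive.

Import Order.TTheory GRing.Theory Num.Theory.
Local Open Scope ring_scope.

Section Graphs.
Variables (V : finType) (e : rel V).

Definition simple_graph := symmetric e /\ irreflexive e.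

Definition connected_graph := (0 < #|V|)%N /\ forall u v, connect e u v.

Definition induced (S : {set V}) : rel V :=
  [rel u v | [&& u \in S, v \in S & e u v]].

Definition components (S : {set V}) : {set {set V}} :=
  equivalence_partition (connect (induced S)) S.

End Graphs.

Section GeneralizedLaplacians.
Variables (R : realType) (V : finType).

(* Rows and columns are indexed by vertices through enum_rank. *)
Definition generalized_laplacian (e : rel V) (M : 'M[R]_#|V|) :=
  [/\ M^T = M,
      forall u v, u != v -> ~~ e u v -> M (enum_rank u) (enum_rank v) = 0
    & forall u v, e u v -> M (enum_rank u) (enum_rank v) < 0].

Definition col_of (f : {ffun V -> R}) : 'cV[R]_#|V| :=
  \col_i f (enum_val i).

Definition eigenvector (M : 'M[R]_#|V|) (a : R) (f : {ffun V -> R}) :=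
  f != 0 /\ M *m col_of f = a *: col_of f.

Definition spectrum n (M : 'M[R]_n) (lam : n.-tuple R) :=
  sorted <=%R lam /\ char_poly M = \prod_(a <- lam) ('X - a%:P).

Definition simple_eigenvalue n (M : 'M[R]_n) (a : R) :=
  mup a (char_poly M) = 1%N.

End GeneralizedLaplacians.

Section NodalDomains.
Variables (R : realType) (V : finType) (e : rel V).
Implicit Types f g h : {ffun V -> R}.

Definition urschel f : {set V} := [set v | f v == 0].

Definition shallow_urschel f : {set V} :=
  [set v in urschel f | [exists u, e v u && (u \notin urschel f)]].

Definition strong_nodal_domains f : {set {set V}} :=
  components e [set v | 0 < f v] :|: components e [set v | f v < 0].

Definition SND f : nat := #|strong_nodal_domains f|.

Definition signing f g := forall v,
  [/\ g v != 0, 0 < f v -> 0 < g v & f v < 0 -> g v < 0].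

Definition signing_equiv g h := [forall v, Num.sg (g v) == Num.sg (h v)].

(* The signing that is positive exactly on T among the zeros of f: as T ranges
   over the subsets of [urschel f], one signing per equivalence class. *)
Definition sign_choice f (T : {set V}) : {ffun V -> R} :=
  [ffun v => if f v == 0 then (if v \in T then 1 else -1) else f v].

Definition SND_signings f : seq nat :=
  sort leq [seq SND (sign_choice f T) | T <- enum (powerset (urschel f))].

(* Indexed from 1, for 1 <= i <= 2 ^ #|urschel f|; [UNE] below shows that the
   choice of representatives is immaterial. *)
Definition UN f (i : nat) : nat := nth 0%N (SND_signings f) i.-1.

Definition ordered_representatives f (gs : seq {ffun V -> R}) :=
  [/\ forall g, g \in gs -> signing f g,
      pairwise (fun g h => ~~ signing_equiv g h) gs,
      forall g, signing f g -> exists2 h, h \in gs & signing_equiv g h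
    & sorted leq [seq SND g | g <- gs]].

Lemma sign_choiceP f T : signing f (sign_choice f T).
Proof.
move=> v; rewrite ffunE; case: (eqVneq (f v) 0) => [->|fv0]; last by split.
by rewrite ltxx; split=> //; case: ifP; rewrite ?oppr_eq0 oner_eq0.
Qed.

Lemma signing_equiv_SND g h : signing_equiv g h -> SND g = SND h.
Proof.
move=> /forallP gh; rewrite /SND /strong_nodal_domains.
have -> : [set v | 0 < g v] = [set v | 0 < h v].
  by apply/setP=> v; rewrite !inE -[LHS]sgr_gt0 (eqP (gh v)) sgr_gt0.
have -> // : [set v | g v < 0] = [set v | h v < 0].
by apply/setP=> v; rewrite !inE -[LHS]sgr_lt0 (eqP (gh v)) sgr_lt0.
Qed.

Let pos_zeros f g : {set V} := [set v in urschel f | 0 < g v].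

Let sign_choice_pos_zeros f g :
  signing f g -> signing_equiv g (sign_choice f (pos_zeros f g)).
Proof.
move=> fg; apply/forallP=> v; rewrite ffunE !inE; have [gv0 gp gn] := fg v.
case: (ltgtP (f v) 0) => [fv|fv|fv] /=.
- by rewrite !ltr0_sg ?gn.
- by rewrite !gtr0_sg ?gp.
- by case: (ltgtP (g v) 0) gv0 => // gv _;
     rewrite ?sgr1 ?sgrN1 ?(ltr0_sg gv) ?(gtr0_sg gv).
Qed.

Let signing_equiv_pos_zeros f g h :
  signing_equiv g h -> pos_zeros f g = pos_zeros f h.
Proof.
move=> /forallP gh; apply/setP=> v.
by rewrite !inE -[0 < g v]sgr_gt0 (eqP (gh v)) sgr_gt0.
Qed.

Let pos_zeros_sign_choice f (T : {set V}) :
  T \subset urschel f -> pos_zeros f (sign_choice f T) = T.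
Proof.
move=> /subsetP sT; apply/setP=> v; rewrite !inE ffunE.
case: eqP => [_|fv] /=; last by apply/esym/negP=> /sT; rewrite inE => /eqP.
by case: ifP; rewrite ?ltr01 ?oppr_gt0 ?ltr10.
Qed.

Lemma ordered_representatives_SND f gs : ordered_representatives f gs ->
  [seq SND g | g <- gs] = SND_signings f.
Proof.
case=> gsS gsI gsC gsO; apply: (sorted_eq leq_trans anti_leq) => //.
  exact: sort_sorted leq_total _.
rewrite /SND_signings perm_sym perm_sort perm_sym.
have -> : [seq SND g | g <- gs] =
    [seq SND (sign_choice f T) | T <- map (pos_zeros f) gs].
  rewrite -map_comp; apply/eq_in_map=> g /gsS fg /=.
  exact/signing_equiv_SND/sign_choice_pos_zeros.
apply/perm_map/uniq_perm; rewrite ?enum_uniq //.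
  rewrite uniq_pairwise pairwise_map.
  have neq : {in mem gs &, subrel (fun g h => ~~ signing_equiv g h)
                 (relpre (pos_zeros f) [rel T U | T != U])}.
    move=> g h /gsS fg /gsS fh /=.
    apply: contra => /eqP eq_gh; apply/forallP=> v.
    have /forallP/(_ v)/eqP-> := sign_choice_pos_zeros fg.
    by rewrite eq_gh; have /forallP/(_ v)/eqP-> := sign_choice_pos_zeros fh.
  exact: (sub_in_pairwise neq (allss gs) gsI).
move=> T; rewrite mem_enum powersetE; apply/mapP/idP => [[g _ ->]|sT].
  by apply/subsetP=> v; rewrite inE => /andP[].
have [h hgs gh] := gsC _ (sign_choiceP f T).
by exists h => //; rewrite -(signing_equiv_pos_zeros f gh) pos_zeros_sign_choice.
Qed.

Lemma UNE f gs i : ordered_representatives f gs ->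
  (0 < i <= 2 ^ #|urschel f|)%N -> UN f i = SND (nth 0 gs i.-1).
Proof.
move=> Hgs /andP[i_gt0 le_i]; have E := ordered_representatives_SND Hgs.
rewrite /UN -E (nth_map 0) // prednK // -(size_map SND) E.
by rewrite size_sort size_map -cardE card_powerset.
Qed.

End NodalDomains.

(* Main.v *)
Require Import Defs.
From mathcomp Require Import all_boot all_order all_algebra reals complex ring lra.

(* Fix arbitrary signs on the shallow Urschel vertices and let each connected
   component of deep vertices copy the sign of a shallow vertex adjacent to it.
   The eigenvector equation at a shallow vertex forces it to have neighbours of
   both signs, so every strong nodal domain of the resulting signing contains a
   vertex where f_k does not vanish.  Hence the functions c f_k, with c constant
   on each nodal domain, form a space of dimension SND.  On it the form of
   M - lambda_k equals - 1/2 sum_(u,v) M_uv f_u f_v (c_u - c_v)^2 <= 0, so by the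
   spectral theorem SND is at most the number of eigenvalues <= lambda_k, which
   is k since lambda_k is simple.  The 2^s choices of signs on the shallow
   vertices give inequivalent signings. *)

Set Implicit Arguments.
Unset Strict Implicit.
Unset Printing Implicit Defensive.

Import Order.TTheory GRing.Theory Num.Theory.
Local Open Scope ring_scope.
Local Open Scope sesquilinear_scope.

(** * Counting in sorted sequences *)

Lemma sorted_nth_le_count (s : seq nat) (x i : nat) :
  sorted leq s -> (i < count (fun y => y <= x) s)%N -> (nth 0%N s i <= x)%N.
Proof.
move=> s_sorted; apply: contraLR; rewrite -ltnNge -leqNgt => x_lt.
have drop0 : count (fun y => y <= x)%N (drop i s) = 0%N.
  apply/eqP; rewrite -leqn0 leqNgt -has_count; apply/hasPn => y /(nthP 0%N) [j].
  rewrite size_drop nth_drop ltn_subRL => j_lt <-.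
  rewrite -ltnNge (leq_trans x_lt) //.
  apply: (sorted_leq_nth leq_trans leqnn) => //; rewrite ?inE ?leq_addr //.
  by rewrite (leq_ltn_trans _ j_lt) ?leq_addr.
rewrite -(cat_take_drop i s) count_cat drop0 addn0.
by rewrite (leq_trans (count_size _ _)) // size_take_min geq_minl.
Qed.

(** Simplicity makes every entry after position [i] strictly larger than the one at [i], so only the
    first [i.+1] entries can be counted. Positions start at 0: the eigenvalue of index k sits at
    [k.-1]. *)
Lemma count_le_simple (R : realDomainType) (s : seq R) (i : nat) :
  sorted <=%R s -> (i < size s)%N -> count_mem s`_i s = 1%N ->
  (count (fun y => y <= s`_i)%R s <= i.+1)%N.
Proof.
move=> s_sorted i_lt s_i.
have drop0 : count (fun y => y <= s`_i)%R (drop i.+1 s) = 0%N.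
  apply/eqP; rewrite -leqn0 leqNgt -has_count; apply/hasPn => y ys.
  have le_y : s`_i <= y.
    move: ys => /(nthP 0) [j]; rewrite size_drop nth_drop ltn_subRL => j_lt <-.
    apply: (sorted_leq_nth le_trans lexx 0 s_sorted); rewrite ?inE //.
    by rewrite addSn -addnS leq_addr.
  rewrite -ltNge lt_neqAle le_y andbT; apply/eqP => y_eq.
  move: s_i; rewrite -{2}(cat_take_drop i.+1 s) count_cat (take_nth 0) //.
  rewrite -cats1 count_cat /= eqxx y_eq addn0 addn1 addSn => -[] /eqP.
  by rewrite addn_eq0 -[X in _ && X]leqn0 leqNgt -has_count has_pred1 ys andbF.
rewrite -[X in count _ X](cat_take_drop i.+1 s) count_cat drop0 addn0.
by rewrite (leq_trans (count_size _ _)) // size_takel.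
Qed.

(** * Eigenvalues and quadratic forms *)

Lemma char_poly_similar (R : comNzRingType) n (P Q D : 'M[R]_n) :
  Q *m P = 1%:M -> char_poly (Q *m D *m P) = char_poly D.
Proof.
move=> QP; rewrite /char_poly /char_poly_mx.
have QPC : map_mx polyC Q *m map_mx polyC P = 1%:M by rewrite -map_mxM QP map_mx1.
transitivity (\det (map_mx polyC Q *m ('X%:M - map_mx polyC D) *m map_mx polyC P)).
  by rewrite mulmxBr mulmxBl !map_mxM scalar_mxC -[_%:M *m _ *m _]mulmxA QPC mulmx1.
by rewrite !det_mulmx mulrAC -det_mulmx QPC det1 mul1r.
Qed.

(** One half of the Courant-Fischer principle: a nonzero vector of the row space of [Y] orthogonal
    to all eigenvectors with eigenvalue at most [a] would make the form positive. *)
Lemma normal_nonpos_le_count (C : numClosedFieldType) m n (A : 'M[C]_n)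
    (s : seq C) (a : C) (Y : 'M[C]_(m, n)) :
  A \is normalmx -> char_poly A = \prod_(b <- s) ('X - b%:P) ->
  {in s, forall b, b \is Num.real} -> a \is Num.real -> row_free Y ->
  (forall c : 'rV_m, ((c *m Y) *m (A - a%:M) *m (c *m Y)^t*) 0 0 <= 0) ->
  (m <= count (fun b => b <= a)%R s)%N.
Proof.
move=> /orthomx_spectralP; set P := spectralmx A; set d := spectral_diag A.
move=> A_eq chA s_real a_real Y_free Y_nonpos.
have P_unit : P \is unitarymx := spectral_unitarymx A.
rewrite invmx_unitary // in A_eq.
have PtP : P^t* *m P = 1%:M.
  by rewrite -(invmx_unitary P_unit) mulVmx ?spectral_unit.
have s_perm : perm_eq s [seq d 0 i | i <- index_enum 'I_n].
  apply: prod_XsubC_eq; rewrite big_map -chA A_eq char_poly_similar //.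
  rewrite char_poly_trig ?diag_mx_is_trig //.
  by apply: eq_bigr => i _; rewrite mxE eqxx.
have d_real i : d 0 i \is Num.real.
  apply: s_real; rewrite (perm_mem s_perm); apply/mapP.
  by exists i; rewrite ?mem_index_enum.
pose I := [pred i | d 0 i <= a].
have -> : count (fun b => b <= a)%R s = #|I|.
  rewrite (permP s_perm) count_map -sum1_count sum1_card.
  by apply: eq_card => i; rewrite !inE.
(* [B] holds the coordinates of the rows of [Y] along the eigenvectors with eigenvalue at most [a].
   It has [#|I|] columns, so it suffices that its rows are independent. *)
pose B := colsub (enum_val : 'I_#|I| -> 'I_n) (Y *m P^t*).
suff /eqP <- : row_free B by exact: rank_leq_col.
apply: inj_row_free => c cB0.
pose z := c *m (Y *m P^t*).
have z0 i : d 0 i <= a -> z 0 i = 0.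
  move=> iI; have := congr1 (fun v : 'rV__ => v 0 (enum_rank_in iI i)) cB0.
  rewrite /B mulmx_colsub 2!mxE enum_rankK_in // [RHS]mxE => czi.
  by rewrite mxE.
suff zz : z = 0.
  have cY : c *m Y = 0.
    by rewrite -[c *m Y]mulmx1 -PtP !mulmxA -[c *m Y *m _]mulmxA -/z zz mul0mx.
  by apply/(row_free_inj Y_free); rewrite cY mul0mx.
have zE : (c *m Y) *m (A - a%:M) *m (c *m Y)^t* = z *m (diag_mx d - a%:M) *m z^t*.
  have -> : z^t* = P *m (c *m Y)^t* by rewrite /z mulmxA trmx_mul map_mxM trmxCK.
  have -> : A - a%:M = P^t* *m (diag_mx d - a%:M) *m P.
    by rewrite mulmxBr mulmxBl -A_eq scalar_mxC -mulmxA PtP mulmx1.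
  by rewrite /z !mulmxA.
have := Y_nonpos c; rewrite {}zE mxE.
(* Where [d 0 i <= a] the coordinate [z 0 i] vanishes, and elsewhere its weight is positive. A
   nonpositive sum of such terms forces [z] to be 0. *)
have t_ge0 i : 0 <= (d 0 i - a) * (z 0 i * (z 0 i)^*).
  have [/z0 ->|di] := boolP (d 0 i <= a); first by rewrite mul0r mulr0.
  by rewrite mulr_ge0 ?mul_conjC_ge0 // subr_ge0 ltW // real_ltNge.
have -> : \sum_j (z *m (diag_mx d - a%:M)) 0 j * z^t* j 0 =
          \sum_j (d 0 j - a) * (z 0 j * (z 0 j)^*).
  apply: eq_bigr => j _; rewrite mulmxBr mul_mx_scalar mul_mx_diag !mxE; ring.
move=> sum_le0; apply/rowP => i; rewrite [RHS]mxE.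
have [/z0 //|di] := boolP (d 0 i <= a).
have: \sum_j (d 0 j - a) * (z 0 j * (z 0 j)^*) == 0.
  by rewrite eq_le sum_le0 sumr_ge0.
rewrite psumr_eq0 // => /allP /(_ i (mem_index_enum i)).
rewrite mulf_eq0 subr_eq0 mul_conjC_eq0 => /orP[/eqP da|/eqP //].
by rewrite da lexx in di.
Qed.

Lemma map_real_complex_conj (R : rcfType) m n (A : 'M[R]_(m, n)) :
  map_mx Num.conj (map_mx (real_complex R) A) = map_mx (real_complex R) A.
Proof. by rewrite -map_mx_comp; apply: eq_map_mx => x /=; exact: conjc_real. Qed.

Lemma complex_quadratic_form (R : rcfType) n (N : 'M[R]_n) (x y : 'rV[R]_n) :
  N^T = N ->
  let z := map_mx (real_complex R) x + 'i%C *: map_mx (real_complex R) y in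
  (z *m map_mx (real_complex R) N *m z^t*) 0 0 =
  real_complex R ((x *m N *m x^T) 0 0 + (y *m N *m y^T) 0 0).
Proof.
move=> N_sym z; rewrite {}/z; set j := real_complex R.
(* A 1 by 1 matrix equals its transpose. This makes the imaginary cross terms cancel. *)
have yNx : y *m N *m x^T = x *m N *m y^T.
  by rewrite [LHS]mx11_scalar -tr_scalar_mx -mx11_scalar
    !trmx_mul trmxK N_sym mulmxA.
have -> : (map_mx j x + 'i%C *: map_mx j y)^t* =
          map_mx j x^T - 'i%C *: map_mx j y^T.
  apply/colP => i; rewrite !mxE; by simpc.
rewrite !(mulmxDl, mulmxBr) -?scalemxAl -?scalemxAr -?scalemxAl -!map_mxM yNx.
by rewrite scalerA -expr2 sqr_i scaleN1r opprD opprK addrA addrK -map_mxD !mxE.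
Qed.

(** Over the complex numbers [M] becomes Hermitian, hence normal. The form at a complex combination
    of the rows is the sum of its values at the real and imaginary parts, both nonpositive. *)
Lemma symmetric_nonpos_le_count (R : rcfType) m n (M : 'M[R]_n)
    (s : seq R) (a : R) (Y : 'M[R]_(m, n)) :
  M^T = M -> char_poly M = \prod_(b <- s) ('X - b%:P) -> row_free Y ->
  (forall c : 'rV_m, ((c *m Y) *m (M - a%:M) *m (c *m Y)^T) 0 0 <= 0) ->
  (m <= count (fun b => b <= a)%R s)%N.
Proof.
move=> M_sym chM Y_free Y_nonpos; pose j := real_complex R.
have -> : count (fun b => b <= a)%R s =
    count (fun b => b <= j a) [seq j b | b <- s].
  by rewrite count_map; apply: eq_count => b /=; rewrite lecR.
have j_real b : j b \is Num.real by rewrite complex_real.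
apply: (@normal_nonpos_le_count _ _ _ (map_mx j M) _ _ (map_mx j Y)) => //.
- by rewrite qualifE /= map_trmx M_sym map_real_complex_conj.
- rewrite -map_char_poly chM rmorph_prod big_map.
  by apply: eq_bigr => b _; rewrite /= map_polyXsubC.
- by move=> _ /mapP[b _ ->].
- by rewrite row_free_map.
move=> c; pose x := map_mx (@complex.Re R) c; pose y := map_mx (@complex.Im R) c.
have cE : c = map_mx j x + 'i%C *: map_mx j y.
  by apply/rowP => i; rewrite !mxE -complexE.
have -> : c *m map_mx j Y = map_mx j (x *m Y) + 'i%C *: map_mx j (y *m Y).
  by rewrite {1}cE mulmxDl -scalemxAl !map_mxM.
have -> : map_mx j M - (j a)%:M = map_mx j (M - a%:M).
  by rewrite map_mxB map_scalar_mx.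
rewrite complex_quadratic_form; last by rewrite linearB /= M_sym tr_scalar_mx.
rewrite (_ : 0 = j 0) // lecR.
by rewrite -oppr_ge0 opprD addr_ge0 // oppr_ge0.
Qed.

(** By the eigenvector equation the row sums of [q] are [a * f i ^+ 2]. Expanding the square then
    shows that the sum of [q i j * (c i - c j) ^+ 2] is minus twice the form. *)
Lemma modulated_eigenvector_form_le0 (R : realFieldType) n (M : 'M[R]_n) (a : R)
    (f c : 'I_n -> R) (y := \row_i (c i * f i)) :
  M^T = M -> (forall i, \sum_j M i j * f j = a * f i) ->
  (forall i j, 0 <= M i j * (f i * f j) * (c i - c j) ^+ 2) ->
  (y *m (M - a%:M) *m y^T) 0 0 <= 0.
Proof.
move=> M_sym Mf M_ge0.
have MC i j : M i j = M j i by rewrite -{1}M_sym mxE.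
pose q i j := M i j * (f i * f j).
have qE i : \sum_j q i j = a * f i ^+ 2.
  under eq_bigr do rewrite /q mulrCA.
  by rewrite -mulr_sumr Mf; ring.
have formE : (y *m (M - a%:M) *m y^T) 0 0 =
    \sum_i \sum_j c i * c j * q i j - \sum_i c i ^+ 2 * (a * f i ^+ 2).
  rewrite mulmxBr mulmxBl mul_mx_scalar -scalemxAl !mxE; congr (_ - _).
    rewrite exchange_big; apply: eq_bigr => j _; rewrite !mxE mulr_suml.
    by apply: eq_bigr => i _; rewrite !mxE /q; ring.
  by rewrite mulr_sumr; apply: eq_bigr => i _; rewrite !mxE; ring.
have : 0 <= \sum_i \sum_j q i j * (c i - c j) ^+ 2.
  by apply: sumr_ge0 => i _; apply: sumr_ge0 => j _; exact: M_ge0.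
have -> : \sum_i \sum_j q i j * (c i - c j) ^+ 2 =
    \sum_i \sum_j c i ^+ 2 * q i j + \sum_i \sum_j c j ^+ 2 * q i j
    - 2 * \sum_i \sum_j c i * c j * q i j.
  rewrite mulr_sumr -big_split -sumrB; apply: eq_bigr => i _ /=.
  rewrite mulr_sumr -big_split -sumrB; apply: eq_bigr => j _ /=; ring.
have -> : \sum_i \sum_j c j ^+ 2 * q i j = \sum_i \sum_j c i ^+ 2 * q i j.
  rewrite exchange_big; apply: eq_bigr => i _; apply: eq_bigr => j _.
  by rewrite /q MC [f _ * _]mulrC.
under [X in X + X - _]eq_bigr do rewrite -mulr_sumr qE.
rewrite formE; lra.
Qed.

(** * Connected components and strong nodal domains *)

Section Components.
Variables (V : finType) (e : rel V).
Hypothesis e_sym : symmetric e.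
Implicit Types (S D : {set V}) (u v : V).

Lemma induced_sym S : symmetric (induced e S).
Proof. by move=> u v; rewrite /induced /= e_sym andbCA. Qed.

Lemma connect_stable S D u v :
  (forall x y, x \in D -> induced e S x y -> y \in D) ->
  u \in D -> connect (induced e S) u v -> v \in D.
Proof.
move=> D_stable uD uv; rewrite -(closed_connect _ uv) //.
apply: intro_closed => [|x y xy xD]; last exact: D_stable xy.
exact/sym_connect_sym/induced_sym.
Qed.

Lemma componentsP S D :
  reflect (exists2 u, u \in S & D = [set v in S | connect (induced e S) u v])
          (D \in components e S).
Proof. by apply: (iffP imsetP). Qed.

Lemma components_edge S D u v :
  D \in components e S -> u \in D -> v \in S -> e u v -> v \in D.
Proof.
move=> /componentsP[w _ ->]; rewrite !inE => /andP[uS wu] vS uv; rewrite vS.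
by apply: connect_trans wu (connect1 _); rewrite /induced /= uS vS uv.
Qed.

Lemma components_inj S D1 D2 v :
  D1 \in components e S -> D2 \in components e S -> v \in D1 -> v \in D2 -> D1 = D2.
Proof.
have symS := sym_connect_sym (induced_sym S).
move=> /componentsP[u1 _ ->] /componentsP[u2 _ ->].
rewrite !inE => /andP[_ u1v] /andP[_ u2v]; apply/setP => x; rewrite !inE.
by rewrite (same_connect symS u1v) (same_connect symS u2v).
Qed.

Lemma components_subset S D : D \in components e S -> D \subset S.
Proof.
by move=> /componentsP[u _ ->]; apply/subsetP => v; rewrite inE => /andP[].
Qed.

Lemma components_neq0 S D : D \in components e S -> exists v, v \in D.
Proof. by move=> /componentsP[u uS ->]; exists u; rewrite inE uS connect0. Qed.

Variable R : realType.
Implicit Types f g : {ffun V -> R}.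

Lemma strong_nodal_domains_neq0 g D :
  D \in strong_nodal_domains e g -> exists v, v \in D.
Proof. by rewrite in_setU => /orP[] /components_neq0. Qed.

(** The positive product says that [u] and [v] have the same sign, which treats positive and
    negative domains at once. *)
Lemma strong_nodal_domains_edge g D u v :
  D \in strong_nodal_domains e g -> u \in D -> e u v -> 0 < g u * g v ->
  v \in D.
Proof.
rewrite in_setU => /orP[] DS uD uv; have := subsetP (components_subset DS) u uD.
  rewrite inE => gu; rewrite pmulr_rgt0 // => gv.
  by apply: (components_edge DS uD _ uv); rewrite inE.
rewrite inE => gu; rewrite nmulr_rgt0 // => gv.
by apply: (components_edge DS uD _ uv); rewrite inE.
Qed.

Lemma strong_nodal_domains_inj g D1 D2 v :
  D1 \in strong_nodal_domains e g -> D2 \in strong_nodal_domains e g ->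
  v \in D1 -> v \in D2 -> D1 = D2.
Proof.
rewrite !in_setU => /orP[] D1S /orP[] D2S vD1 vD2;
  try exact: (components_inj D1S D2S vD1 vD2).
  have := subsetP (components_subset D1S) v vD1.
  have := subsetP (components_subset D2S) v vD2.
  by rewrite !inE => /ltW; rewrite ltNge => ->.
have := subsetP (components_subset D1S) v vD1.
have := subsetP (components_subset D2S) v vD2.
by rewrite !inE => /ltW; rewrite leNgt => /negP.
Qed.

End Components.

(** * Signings of an eigenvector *)

Section EigenvectorSignings.
Variables (R : realType) (V : finType) (e : rel V).
Variables (M : 'M[R]_#|V|) (a : R) (f : {ffun V -> R}).
Hypotheses (e_sym : symmetric e) (M_lap : generalized_laplacian e M).
Hypothesis Mf : M *m col_of f = a *: col_of f.

Lemma eigenvector_sum i : \sum_j M i j * f (enum_val j) = a * f (enum_val i).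
Proof.
have := congr1 (fun y : 'cV__ => y i 0) Mf; rewrite !mxE => <-.
by apply: eq_bigr => j _; rewrite mxE.
Qed.

Lemma SND_le_eigenvalue_count (s : seq R) (g : {ffun V -> R}) :
  char_poly M = \prod_(b <- s) ('X - b%:P) -> signing f g ->
  (forall D, D \in strong_nodal_domains e g -> exists2 v, v \in D & f v != 0) ->
  (SND e g <= count (fun b => b <= a)%R s)%N.
Proof.
move=> chM fg domf; have [M_sym M_nadj M_adj] := M_lap.
set N := strong_nodal_domains e g in domf.
pose ind (i : 'I_#|N|) (v : V) : R := (v \in enum_val i)%:R.
(* The rows of [Y] are the restrictions of [f] to the nodal domains of [g], so [c *m Y] is [f]
   multiplied by a function constant on each domain. *)
pose Y := \matrix_(i < #|N|, j < #|V|) (ind i (enum_val j) * f (enum_val j)).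
pose coef (c : 'rV_#|N|) v := \sum_i c 0 i * ind i v.
have cY c : c *m Y = \row_j (coef c (enum_val j) * f (enum_val j)).
  apply/rowP => j; rewrite !mxE mulr_suml; apply: eq_bigr => i _.
  by rewrite mxE mulrA.
apply: (@symmetric_nonpos_le_count _ _ _ M _ _ Y) => //.
  (* Domains are disjoint, so evaluation at a vertex of domain [i] where [f] does not vanish
     isolates [c 0 i]. *)
  apply: inj_row_free => c cY0; apply/rowP => i; rewrite mxE.
  have iN : enum_val i \in N := enum_valP i.
  have [v vi fv] := domf _ iN.
  have : (c *m Y) 0 (enum_rank v) = 0 by rewrite cY0 mxE.
  rewrite cY mxE enum_rankK => /eqP; rewrite mulf_eq0 (negPf fv) orbF => /eqP.
  rewrite /coef (bigD1 i) //= /ind vi mulr1 big1 ?addr0 // => i' i'i.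
  have [vi'|_] := boolP (v \in enum_val i'); last by rewrite mulr0.
  case/eqP: i'i; apply: enum_val_inj.
  exact: (strong_nodal_domains_inj e_sym (enum_valP i') iN vi' vi).
move=> c; rewrite cY.
apply: (@modulated_eigenvector_form_le0 _ _ M a (fun i => f (enum_val i))) => //.
  exact: eigenvector_sum.
move=> p q; rewrite -[p]enum_valK -[q]enum_valK !enum_rankK.
move: (enum_val p) (enum_val q) => u v.
have [->|uv] := eqVneq u v; first by rewrite subrr expr0n mulr0.
have [euv|nuv] := boolP (e u v); last by rewrite M_nadj // !mul0r.
(* Across an edge, either [f u * f v <= 0] and the negative entry of [M] gives the right sign, or
   [u] and [v] share a domain of [g] and the difference is 0. *)
have [fuv|fuv] := leP (f u * f v) 0.
  by rewrite mulr_ge0 ?sqr_ge0 // mulr_le0 // ltW ?M_adj.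
suff -> : coef c u = coef c v by rewrite subrr expr0n mulr0.
have guv : 0 < g u * g v.
  have [_ up un] := fg u; have [_ vp vn] := fg v.
  have [fu|fu|fu] := ltgtP (f u) 0.
  - by rewrite nmulr_rgt0 ?un // vn // -(nmulr_rgt0 _ fu).
  - by rewrite pmulr_rgt0 ?up // vp // -(pmulr_rgt0 _ fu).
  - by rewrite fu mul0r ltxx in fuv.
apply: eq_bigr => i _; rewrite /ind; congr (_ * _%:R); congr nat_of_bool.
apply/idP/idP => [ui|vi].
  exact: (strong_nodal_domains_edge (enum_valP i) ui euv).
by apply: (strong_nodal_domains_edge (enum_valP i) vi); rewrite 1?e_sym 1?mulrC.
Qed.

(** The sign of [b] selects the sign wanted for the neighbour. At a zero of [f] the eigenvector
    equation says that the values of [f] at the neighbours, weighted by negative entries of [M], sum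
    to 0. They are not all 0, so both signs occur. *)
Lemma shallow_urschel_neighbor v b :
  v \in shallow_urschel e f -> b != 0 -> exists2 u, e v u & 0 < b * f u.
Proof.
have [_ M_nadj M_adj] := M_lap.
rewrite !inE => /andP[/eqP fv /existsP[w /andP[vw]]]; rewrite inE => fw b0.
have [/exists_inP[u vu bu]|/exists_inPn nb] :=
  boolP [exists u in e v, 0 < b * f u]; first by exists u.
pose t u := M (enum_rank v) (enum_rank u) * (b * f u).
have t_ge0 u : 0 <= t u.
  have [->|vu] := eqVneq u v; first by rewrite /t fv !mulr0.
  have [evu|nvu] := boolP (e v u); last by rewrite /t M_nadj ?mul0r // eq_sym.
  rewrite mulr_le0 ?(ltW (M_adj _ _ _)) // leNgt; exact: nb.
have : \sum_u t u == 0.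
  rewrite (reindex (enum_val : 'I_#|V| -> V)) /=; last first.
    by apply/onW_bij/enum_val_bij.
  under eq_bigr do rewrite /t enum_valK mulrCA.
  by rewrite -mulr_sumr eigenvector_sum enum_rankK fv !mulr0.
rewrite psumr_eq0 // => /allP/(_ w (mem_index_enum w)).
by rewrite /= !mulf_eq0 (negPf b0) (negPf fw) (lt_eqF (M_adj _ _ vw)).
Qed.

Definition deep_urschel : {set V} := urschel f :\: shallow_urschel e f.

(** The predicate depends on [d] only through its component of deep vertices, so [pick] returns the
    same anchor throughout that component. *)
Definition shallow_anchor (d : V) : option V :=
  [pick w in shallow_urschel e f |
    [exists x, connect (induced e deep_urschel) d x && e x w]].

(* Each connected component of deep vertices takes the sign of one shallow
   vertex adjacent to it. *)
Definition deep_extension (T : {set V}) : {set V} :=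
  T :|: [set d in deep_urschel | oapp (mem T) false (shallow_anchor d)].

Lemma shallow_anchor_connect d x :
  connect (induced e deep_urschel) d x -> shallow_anchor d = shallow_anchor x.
Proof.
move=> dx; have dxE := same_connect (sym_connect_sym (induced_sym e_sym _)) dx.
apply: eq_pick => w /=; congr (_ && _).
by apply: eq_existsb => y; rewrite dxE.
Qed.

(** A deep component with no adjacent shallow vertex would be closed under [e], hence be the whole
    connected graph, and [f] would be 0. *)
Lemma shallow_anchorP d : connected_graph e -> f != 0 -> d \in deep_urschel ->
  exists w, [/\ shallow_anchor d = Some w, w \in shallow_urschel e f &
    exists2 x, connect (induced e deep_urschel) d x & e x w].
Proof.
move=> [_ e_conn] f0 dd; rewrite /shallow_anchor.
case: pickP => [w /andP[ws /existsP[x /andP[dx xw]]]|no_w].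
  by exists w; split=> //; exists x.
have [u fu] : exists u, f u != 0.
  apply/existsP; apply: contraNT f0 => /existsPn f0.
  by apply/eqP/ffunP => u; rewrite ffunE; apply/eqP; have := f0 u; rewrite negbK.
pose K := [set x | connect (induced e deep_urschel) d x].
have K_deep x : x \in K -> x \in deep_urschel.
  by rewrite inE => /(connect_stable e_sym); apply=> // y z _ /and3P[].
suff /K_deep : u \in K by rewrite !inE (negPf fu) andbF.
have dK : d \in K by rewrite inE.
rewrite -(closed_connect _ (e_conn d u)) //; apply: intro_closed => [|x y xy xK].
  exact: sym_connect_sym.
(* A neighbour [y] of the deep vertex [x] is a zero of [f], as [x] is not shallow, and is not
   shallow itself by [no_w]. So [y] is deep and lies in [K]. *)
have xd := K_deep x xK; have := xd; rewrite !inE => /andP[xs xu].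
have yu : f y == 0.
  by apply: contraNT xs => fy; rewrite xu; apply/existsP; exists y; rewrite xy inE.
have ys : y \notin shallow_urschel e f.
  apply/negP => ys; have := no_w y; rewrite ys => /existsP[]; exists x.
  by rewrite xy andbT; rewrite inE in xK.
have yd : y \in deep_urschel by rewrite in_setD ys inE.
move: xK; rewrite inE => /connect_trans; apply; apply: connect1.
by rewrite /induced /= yd xy xd.
Qed.

Lemma deep_extension_domain (T D : {set V}) :
  connected_graph e -> f != 0 ->  T \subset shallow_urschel e f ->
  D \in strong_nodal_domains e (sign_choice f (deep_extension T)) ->
  exists2 v, v \in D & f v != 0.
Proof.
move=> e_conn f0 sT DN; have [v vD] := strong_nodal_domains_neq0 DN.
set g := sign_choice f (deep_extension T) in DN.
have gE u : f u != 0 -> g u = f u by rewrite /g ffunE => /negPf->.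
have g0 u : g u != 0 by have [] := sign_choiceP f (deep_extension T) u.
have shallowD u : u \in D -> u \in shallow_urschel e f ->
    exists2 v, v \in D & f v != 0.
  (* Taking [b] to be [g u] yields a neighbour where [f], and hence [g], has the sign of [g u]. It
     lies in the same domain. *)
  move=> uD us; have [w uw] := shallow_urschel_neighbor us (g0 u).
  have [->|fw guw] := eqVneq (f w) 0; first by rewrite mulr0 ltxx.
  by exists w => //; apply: (strong_nodal_domains_edge DN uD uw); rewrite (gE w).
have [fv|fv] := eqVneq (f v) 0; last by exists v.
have [vs|vs] := boolP (v \in shallow_urschel e f); first exact: shallowD vs.
have vd : v \in deep_urschel by rewrite in_setD vs inE fv eqxx.
have g_deep x : x \in deep_urschel ->
    g x = if oapp (mem T) false (shallow_anchor x) then 1 else -1.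
  move=> xd; have /setDP[xu xs] := xd; have fx : f x == 0 by rewrite inE in xu.
  rewrite /g ffunE fx in_setU [x \in [set _ in _ | _]]inE xd /=.
  by rewrite (contraNF (subsetP sT x) xs).
have g_shallow x : x \in shallow_urschel e f -> g x = if x \in T then 1 else -1.
  move=> xs; have fx : f x == 0 by move: xs; rewrite !inE => /andP[].
  by rewrite /g ffunE fx in_setU [x \in [set _ in _ | _]]inE in_setD xs /= orbF.
have sq (B : bool) : 0 < (if B then 1 else -1 : R) * (if B then 1 else -1).
  by case: B; rewrite ?mulrNN mulr1.
have [w [vw ws [x vx xw]]] := shallow_anchorP e_conn f0 vd.
(* [g] is constant on the deep component of [v], so the path from [v] to [x] stays in [D]. One more
   edge reaches the anchor [w], which has the same sign. *)
have /andP[xD xd] : (x \in D) && (x \in deep_urschel).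
  rewrite -in_setI; apply: (connect_stable e_sym _ _ vx); last by rewrite inE vD vd.
  move=> y z /setIP[yD yd] yz; have /and3P[_ zd eyz] := yz.
  rewrite inE zd andbT; apply: (strong_nodal_domains_edge DN yD eyz).
  by rewrite !g_deep // (shallow_anchor_connect (connect1 yz)) sq.
apply: (shallowD w) => //; apply: (strong_nodal_domains_edge DN xD xw).
by rewrite (g_deep _ xd) (g_shallow _ ws) -(shallow_anchor_connect vx) vw sq.
Qed.

(** [T] can be recovered from its extension, so different sign choices on the shallow vertices give
    inequivalent signings. *)
Lemma deep_extension_shallow (T : {set V}) : T \subset shallow_urschel e f ->
  shallow_urschel e f :&: deep_extension T = T.
Proof.
move=> sT; rewrite setIUr (setIidPr sT)
  (_ : _ :&: [set _ in _ | _] = set0) ?setU0 //.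
by apply/setP => v; rewrite 2!inE in_set0 in_setD;
  case: (v \in shallow_urschel e f).
Qed.

Lemma deep_extension_urschel (T : {set V}) : T \subset shallow_urschel e f ->
  deep_extension T \subset urschel f.
Proof.
move=> sT; rewrite subUset; apply/andP; split.
  by apply: subset_trans sT _; apply/subsetP => v; rewrite inE => /andP[].
by apply/subsetP => v; rewrite inE => /andP[/setDP[]].
Qed.

End EigenvectorSignings.

Theorem theorem2p11 (R : realType) (V : finType) (e : rel V)
    (M : 'M[R]_#|V|) (lam : #|V|.-tuple R) (k : nat) (fk : {ffun V -> R})
    (G_simple : simple_graph e) (G_connected : connected_graph e)
    (M_laplacian : generalized_laplacian e M)
    (M_spectrum : spectrum M lam)
    (k_range : (1 <= k <= #|V|)%N)
    (k_simple : simple_eigenvalue M lam`_k.-1)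
    (fk_eigen : eigenvector M lam`_k.-1 fk) :
  (UN e fk (2 ^ #|shallow_urschel e fk|) <= k)%N.
Proof.
have [e_sym _] := G_simple; have [lam_sorted chM] := M_spectrum.
have [fk0 Mfk] := fk_eigen; have /andP[k_gt0 k_le] := k_range.
pose S := shallow_urschel e fk; pose F := deep_extension e fk.
have SND_F T : T \in powerset S -> (SND e (sign_choice fk (F T)) <= k)%N.
  rewrite powersetE => sT.
  have domF D :=
    deep_extension_domain e_sym M_laplacian Mfk G_connected fk0 sT (D := D).
  apply: leq_trans (SND_le_eigenvalue_count e_sym M_laplacian Mfk chM
    (sign_choiceP _ _) domF) _.
  rewrite -[k in (_ <= k)%N](prednK k_gt0) count_le_simple ?size_tuple ?prednK //.
  by rewrite -mu_prod_XsubC -chM.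
(* It remains to find at least [2 ^ #|S|] sign choices with at most [k] domains. The sets [F T]
   provide them. *)
apply: sorted_nth_le_count; first exact: sort_sorted leq_total _.
rewrite prednK ?expn_gt0 // (permP (permEl (perm_sort _ _))) count_map.
rewrite -card_powerset cardE -(size_map F) -size_filter.
apply: uniq_leq_size.
  rewrite map_inj_in_uniq ?enum_uniq // => T1 T2.
  rewrite !mem_enum !powersetE => sT1 sT2 /(congr1 (setI S)).
  by rewrite !deep_extension_shallow.
move=> _ /mapP[T TS ->]; rewrite mem_enum in TS.
rewrite mem_filter /= SND_F // mem_enum powersetE.
rewrite powersetE in TS; apply: deep_extension_urschel => //.
Qed.
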